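(* Let $(\alpha,\beta,u,v,x)$ be a GSVD component of $(A,B)$. The scaled right generalized singular vector $x_\beta=\frac{x}{\beta}$ satisfies $$\|x_\beta\|\ge\frac{1}{\|B\|}.$$ Let $y=\frac{1}{\sqrt2}\begin{bmatrix}u\\ x_\beta\end{bmatrix}$ be the corresponding eigenvector of $(\widehat A,\widehat B)$, and let $\widehat y$ be an approximate eigenvector, written as $\widehat y=\frac1{\sqrt2}\begin{bmatrix}\widehat u\\ \widehat x\end{bmatrix}$ with $\widehat u\in\mathbb{R}^m$, $\|\widehat u\|=1$, and $0\neq\widehat x\in\mathbb{R}^n$. Set $\widehat v=\frac{B\widehat x}{\|B\widehat x\|}$. Then the approximate generalized singular vectors $\widehat u,\widehat v,\widehat x$ satisfy $$\sin\angle(\widehat x,x)\le\sqrt{1+\frac{1}{\|x_\beta\|^2}}\,\sin\angle(\widehat y,y),$$ $$\sin\angle(\widehat u,u)\le\sqrt{1+\|x_\beta\|^2}\,\sin\angle(\widehat y,y),$$ $$\sin\angle(\widehat v,v)\le\|B\|\sqrt{1+\|x_\beta\|^2}\,\sin\angle(\widehat y,y).$$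
   Context: $\|\cdot\|$ is the 2-norm. $A\in\mathbb{R}^{m\times n}$ ($m\ge n$) and $B\in\mathbb{R}^{p\times n}$ ($p\ge n$) have full column rank $n$. The GSVD of $(A,B)$ is $A=UCX^{-1}$, $B=VSX^{-1}$ with $C=\mathrm{diag}\{\alpha_1,\dots,\alpha_n\}$, $S=\mathrm{diag}\{\beta_1,\dots,\beta_n\}$, $\alpha_i,\beta_i>0$, $\alpha_i^2+\beta_i^2=1$, $X=[x_1,\dots,x_n]$ nonsingular, and $U=[u_1,\dots,u_n]$, $V=[v_1,\dots,v_n]$ with orthonormal columns. Each $(\alpha_i,\beta_i,u_i,v_i,x_i)$ is a GSVD component; a generic one is written $(\alpha,\beta,u,v,x)$, and $\sigma=\alpha/\beta$. Here $$\widehat A=\begin{bmatrix}0&A\\ A^T&0\end{bmatrix},\quad \widehat B=\begin{bmatrix}I_m&0\\ 0&B^TB\end{bmatrix},$$ and $\widehat Ay=\sigma\widehat By$. $\angle(a,b)$ is the acute angle between the lines spanned by nonzero vectors $a,b$, so $\sin\angle(a,b)=\min_{\mu\in\mathbb R}\|b-\mu a\|/\|b\|$. ''Approximate'' carries no quantitative hypothesis. *)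

(* Defs.v *)
From mathcomp Require Import all_boot all_order all_algebra.
From mathcomp Require Import all_classical all_reals all_analysis.

Set Implicit Arguments.
Unset Strict Implicit.
Unset Printing Implicit Defensive.

Import Order.TTheory GRing.Theory Num.Theory.

Local Open Scope classical_set_scope.
Local Open Scope ring_scope.

Definition dotv (R : realType) k (a b : 'cV[R]_k) : R :=
  \sum_(i < k) a i 0 * b i 0.

(* The library's `|a| on matrices is the max norm, hence these two norms. *)
Definition norm2 (R : realType) k (a : 'cV[R]_k) : R := Num.sqrt (dotv a a).

Definition opnorm2 (R : realType) m n (M : 'M[R]_(m, n)) : R :=
  sup [set norm2 (M *m z) | z in [set z : 'cV[R]_n | norm2 z <= 1]].

(* The absolute value makes this the acute angle between the lines spanned by
   [a] and [b]; it is meaningful only for nonzero vectors. *)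
Definition line_angle (R : realType) k (a b : 'cV[R]_k) : R :=
  acos (`|dotv a b| / (norm2 a * norm2 b)).

Record is_gsvd (R : realType) m p n (A : 'M[R]_(m, n)) (B : 'M[R]_(p, n))
    (alphas betas : 'rV[R]_n)
    (U : 'M[R]_(m, n)) (V : 'M[R]_(p, n)) (X : 'M[R]_n) : Prop := IsGSVD {
  gsvd_eqA : A = U *m diag_mx alphas *m invmx X;
  gsvd_eqB : B = V *m diag_mx betas *m invmx X;
  gsvd_alpha_gt0 : forall i, 0 < alphas 0 i;
  gsvd_beta_gt0 : forall i, 0 < betas 0 i;
  gsvd_norm : forall i, alphas 0 i ^+ 2 + betas 0 i ^+ 2 = 1;
  gsvd_unitX : X \in unitmx;
  gsvd_orthU : U^T *m U = 1%:M;
  gsvd_orthV : V^T *m V = 1%:M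
}.

Definition gsvd_component (R : realType) m p n
    (A : 'M[R]_(m, n)) (B : 'M[R]_(p, n)) (alpha beta : R)
    (u : 'cV[R]_m) (v : 'cV[R]_p) (x : 'cV[R]_n) : Prop :=
  exists alphas betas U V X, is_gsvd A B alphas betas U V X /\
  exists i : 'I_n, [/\ alpha = alphas 0 i, beta = betas 0 i,
                       u = col i U, v = col i V & x = col i X].

Definition hatA (R : realType) m n (A : 'M[R]_(m, n)) : 'M[R]_(m + n) :=
  block_mx 0 A A^T 0.

Definition hatB (R : realType) m p n (B : 'M[R]_(p, n)) : 'M[R]_(m + n) :=
  block_mx 1%:M 0 0 (B^T *m B).

Definition pencil_eigenvector (R : realType) k (M N : 'M[R]_k) (lambda : R)
    (y : 'cV[R]_k) : Prop :=
  y != 0 /\ M *m y = lambda *: (N *m y).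

Definition stack (R : realType) m n (u : 'cV[R]_m) (x : 'cV[R]_n) :
    'cV[R]_(m + n) :=
  (Num.sqrt 2)^-1 *: col_mx u x.

(* Main.v *)
Require Import Defs.
From mathcomp Require Import all_boot all_order all_algebra.
From mathcomp Require Import all_classical all_reals all_analysis.
From mathcomp Require Import ring lra.

(** The sine of the angle between the lines of [a] and [b] is the distance of
    [b] to the line of [a], relative to the norm of [b]: every real [mu] gives
    an upper bound, [sin_line_angle_le_dist], and the best one an equality,
    [sin_line_angle_eq_dist].

    Take the optimal [mu] for the stacked vectors [yh = (uh, xh)] and
    [y = (u, xb)], up to the common factor 1/sqrt 2.  The squared distance of
    [y] to [mu *: yh] splits over the two blocks ([sin_line_angle_stack]), so
    that
      |u - mu uh|^2 + |xb - mu xh|^2 = sin(yh, y)^2 (1 + |xb|^2),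
    because |u| = 1.  Thus each block distance is at most
    sin(yh, y) sqrt (1 + |xb|^2).  The same [mu], which is in general not
    optimal for the blocks, then bounds each block angle: dividing by |u| = 1
    bounds the angle of [uh] and [u], and dividing by |xb| bounds the angle of
    [xh] and [x], since [x] and [xb] span the same line.  For the left vector
    [v], the point is that [B *m xb = v]: the distance of [v] to
    [mu *: (B *m xh)], a point of the line of [vh], is |B (xb - mu xh)|, hence
    at most |B| |xb - mu xh|.

    The lower bound on |xb| comes from 1 = |v| = |B xb| <= |B| |xb|.  The
    eigenvector equation reads [A *m xb = sigma *: u] in the first block and
    [A^T *m u = sigma *: (B^T *m v)] in the second; the latter holds because
    with the GSVD both [A^T *m u] and [B^T *m v] are multiples, by alpha and
    beta, of one column of the inverse transpose of the matrix X. *)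

Set Implicit Arguments.
Unset Strict Implicit.
Unset Printing Implicit Defensive.

Import Order.TTheory GRing.Theory Num.Theory.

Local Open Scope ring_scope.

(** * The Euclidean inner product and norm *)

Lemma dotvE (R : realType) k (a b : 'cV[R]_k) : dotv a b = (a^T *m b) 0 0.
Proof. by rewrite mxE; apply: eq_bigr => i _; rewrite mxE. Qed.

Lemma dotvC (R : realType) k (a b : 'cV[R]_k) : dotv a b = dotv b a.
Proof. by apply: eq_bigr => i _; rewrite mulrC. Qed.

Lemma dotvZr (R : realType) k (c : R) (a b : 'cV[R]_k) :
  dotv a (c *: b) = c * dotv a b.
Proof. by rewrite !dotvE -scalemxAr mxE. Qed.

Lemma dotvZl (R : realType) k (c : R) (a b : 'cV[R]_k) :
  dotv (c *: a) b = c * dotv a b.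
Proof. by rewrite dotvC dotvZr dotvC. Qed.

Lemma dotvDr (R : realType) k (a b c : 'cV[R]_k) :
  dotv a (b + c) = dotv a b + dotv a c.
Proof. by rewrite !dotvE mulmxDr mxE. Qed.

Lemma dotv_subZ (R : realType) k (mu : R) (a b : 'cV[R]_k) :
  dotv (b - mu *: a) (b - mu *: a)
  = dotv b b - 2 * mu * dotv a b + mu ^+ 2 * dotv a a.
Proof.
rewrite -scaleNr dotvDr dotvZr !(dotvC (_ + _)) !dotvDr !dotvZr (dotvC b a).
ring.
Qed.

Lemma dotv_col_mx (R : realType) m n (a c : 'cV[R]_m) (b d : 'cV[R]_n) :
  dotv (col_mx a b) (col_mx c d) = dotv a c + dotv b d.
Proof. by rewrite !dotvE tr_col_mx mul_row_col mxE. Qed.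

Lemma dotv_ge0 (R : realType) k (a : 'cV[R]_k) : 0 <= dotv a a.
Proof. by apply: sumr_ge0 => i _; rewrite -expr2 sqr_ge0. Qed.

Lemma dotv_eq0 (R : realType) k (a : 'cV[R]_k) : (dotv a a == 0) = (a == 0).
Proof.
apply/eqP/eqP => [a0|->]; last by rewrite dotvE mulmx0 mxE.
apply/colP => i; rewrite mxE; apply/eqP; rewrite -sqrf_eq0 expr2; apply/eqP.
by apply: (psumr_eq0P _ a0) => // j _; rewrite -expr2 sqr_ge0.
Qed.

Lemma norm2_ge0 (R : realType) k (a : 'cV[R]_k) : 0 <= norm2 a.
Proof. exact: sqrtr_ge0. Qed.

Lemma sqr_norm2 (R : realType) k (a : 'cV[R]_k) : norm2 a ^+ 2 = dotv a a.
Proof. by rewrite sqr_sqrtr ?dotv_ge0. Qed.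

Lemma norm2_eq0 (R : realType) k (a : 'cV[R]_k) : (norm2 a == 0) = (a == 0).
Proof. by rewrite -sqrf_eq0 sqr_norm2 dotv_eq0. Qed.

Lemma norm2Z (R : realType) k (c : R) (a : 'cV[R]_k) :
  norm2 (c *: a) = `|c| * norm2 a.
Proof.
by rewrite /norm2 dotvZr dotvZl mulrA -expr2 sqrtrM ?sqr_ge0// sqrtr_sqr.
Qed.

Lemma cauchy_schwarz (R : realType) k (a b : 'cV[R]_k) :
  dotv a b ^+ 2 <= dotv a a * dotv b b.
Proof.
have [->|a0] := eqVneq a 0; first by rewrite !dotvE trmx0 !mul0mx mxE; lra.
have a_gt0 : 0 < dotv a a by rewrite lt_neqAle eq_sym dotv_eq0 a0 dotv_ge0.
(* The multiple of a that is closest to b. *)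
have := dotv_ge0 (b - (dotv a b / dotv a a) *: a).
rewrite dotv_subZ -(pmulr_rge0 _ a_gt0).
suff -> : dotv a a * (dotv b b - 2 * (dotv a b / dotv a a) * dotv a b
            + (dotv a b / dotv a a) ^+ 2 * dotv a a)
          = dotv a a * dotv b b - dotv a b ^+ 2 by rewrite subr_ge0.
by field; rewrite gt_eqF.
Qed.

(** * The operator norm *)

(** The bound is the Frobenius norm, by Cauchy-Schwarz applied to each row.
    Boundedness is what makes the supremum defining [opnorm2] an upper bound. *)
Lemma norm2_mulmx_bounded (R : realType) m n (M : 'M[R]_(m, n)) :
  has_ubound [set norm2 (M *m z) | z in [set z : 'cV[R]_n | norm2 z <= 1]].
Proof.
exists (Num.sqrt (\sum_i dotv (row i M)^T (row i M)^T)) => _ [z /= z1 <-].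
apply: ler_wsqrtr; rewrite {1}/dotv; apply: ler_sum => i _.
have -> : (M *m z) i 0 = dotv (row i M)^T z.
  by rewrite dotvE trmxK -row_mul [RHS]mxE.
rewrite -expr2; apply: (le_trans (cauchy_schwarz _ _)).
rewrite ler_piMr ?dotv_ge0// -(sqr_norm2 z).
by rewrite expr_le1 ?norm2_ge0.
Qed.

Lemma norm2_mulmx_le (R : realType) m n (M : 'M[R]_(m, n)) (z : 'cV[R]_n) :
  norm2 (M *m z) <= opnorm2 M * norm2 z.
Proof.
have [->|z0] := eqVneq z 0.
  rewrite mulmx0 (eqP (_ : norm2 (0 : 'cV_m) == 0)) ?norm2_eq0//.
  by rewrite (eqP (_ : norm2 (0 : 'cV_n) == 0)) ?norm2_eq0// mulr0.
have z_gt0 : 0 < norm2 z by rewrite lt_neqAle eq_sym norm2_eq0 z0 norm2_ge0.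
rewrite -ler_pdivrMr//.
apply: (ub_le_sup (norm2_mulmx_bounded M)).
have nV : `|(norm2 z)^-1| = (norm2 z)^-1 by rewrite ger0_norm// invr_ge0 ltW.
exists ((norm2 z)^-1 *: z) => /=; first by rewrite norm2Z nV mulVf ?gt_eqF.
by rewrite -scalemxAr norm2Z nV mulrC.
Qed.

Lemma opnorm2_ge0 (R : realType) m n (M : 'M[R]_(m, n)) : 0 <= opnorm2 M.
Proof.
apply: (ub_le_sup (norm2_mulmx_bounded M)).
have n0 k : norm2 (0 : 'cV[R]_k) = 0 by apply/eqP; rewrite norm2_eq0.
by exists 0; rewrite /= ?mulmx0 n0.
Qed.

(** * The sine of an angle as a distance to a line *)

(** The expression is the squared cosine of the angle; for a zero vector the
    quotient is 0. *)
Lemma sqr_cos_le1 (R : realType) k (a b : 'cV[R]_k) :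
  dotv a b ^+ 2 / (dotv a a * dotv b b) <= 1.
Proof.
have := mulr_ge0 (dotv_ge0 a) (dotv_ge0 b).
rewrite le_eqVlt => /predU1P[<-|ab]; first by rewrite invr0 mulr0.
by rewrite ler_pdivrMr// mul1r cauchy_schwarz.
Qed.

Lemma sin_line_angle (R : realType) k (a b : 'cV[R]_k) :
  sin (line_angle a b)
  = Num.sqrt (1 - dotv a b ^+ 2 / (dotv a a * dotv b b)).
Proof.
have q2 : (`|dotv a b| / (norm2 a * norm2 b)) ^+ 2
          = dotv a b ^+ 2 / (dotv a a * dotv b b).
  by rewrite expr_div_n exprMn !sqr_norm2 real_normK ?num_real.
rewrite /line_angle sin_acos ?q2//.
rewrite -ler_norml -(@ler_pXn2r _ 2)// ?nnegrE// expr1n.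
by rewrite real_normK ?num_real// q2 sqr_cos_le1.
Qed.

Lemma sin_line_angle_ge0 (R : realType) k (a b : 'cV[R]_k) :
  0 <= sin (line_angle a b).
Proof. by rewrite sin_line_angle sqrtr_ge0. Qed.

(** Pythagoras: the right-hand side is the squared norm of the component of
    [b] orthogonal to [a].  For [a = 0] the angle is defined as a right angle
    and the quotient is 0, so the identity persists. *)
Lemma sin_line_angle_sqr (R : realType) k (a b : 'cV[R]_k) :
  (sin (line_angle a b) * norm2 b) ^+ 2
  = dotv b b - dotv a b ^+ 2 / dotv a a.
Proof.
have [->|b0] := eqVneq b 0.
  rewrite exprMn sqr_norm2 !(dotvC _ 0) -(scale0r 0) !dotvZl; ring.
have b_n0 : dotv b b != 0 by rewrite dotv_eq0.
rewrite exprMn sqr_norm2 sin_line_angle sqr_sqrtr ?subr_ge0 ?sqr_cos_le1//.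
by rewrite invfM mulrBl mul1r mulrA divfK.
Qed.

(** The excess of the squared distance over the minimal one is a square: it is
    the squared distance from [mu *: a] to the orthogonal projection of [b]. *)
Lemma sin_line_angle_le_dist (R : realType) k (mu : R) (a b : 'cV[R]_k) :
  sin (line_angle a b) * norm2 b <= norm2 (b - mu *: a).
Proof.
rewrite -(@ler_pXn2r _ 2)// ?nnegrE ?norm2_ge0//; last first.
  by rewrite mulr_ge0 ?norm2_ge0 ?sin_line_angle_ge0.
rewrite sin_line_angle_sqr sqr_norm2 dotv_subZ.
have [->|a0] := eqVneq a 0.
  by rewrite -(scale0r 0) !dotvZl; lra.
have a_gt0 : 0 < dotv a a by rewrite lt_neqAle eq_sym dotv_eq0 a0 dotv_ge0.
rewrite -subr_ge0.
suff -> : dotv b b - 2 * mu * dotv a b + mu ^+ 2 * dotv a a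
          - (dotv b b - dotv a b ^+ 2 / dotv a a)
          = (mu * dotv a a - dotv a b) ^+ 2 / dotv a a.
  by rewrite divr_ge0 ?sqr_ge0 ?ltW.
by field; rewrite gt_eqF.
Qed.

Lemma sin_line_angle_eq_dist (R : realType) k (a b : 'cV[R]_k) :
  exists mu, norm2 (b - mu *: a) = sin (line_angle a b) * norm2 b.
Proof.
(* The coefficient of the orthogonal projection of b on the line of a. *)
exists (dotv a b / dotv a a).
apply/eqP; rewrite -(@eqrXn2 _ 2)// ?norm2_ge0//; last first.
  by rewrite mulr_ge0 ?norm2_ge0 ?sin_line_angle_ge0.
rewrite sin_line_angle_sqr sqr_norm2 dotv_subZ; apply/eqP.
have [->|a0] := eqVneq a 0.
  by rewrite -(scale0r 0) !dotvZl; ring.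
by field; rewrite dotv_eq0.
Qed.

(** A single [mu] serves both blocks, which is what couples the angle of the
    stacked vectors to the angles of their parts. *)
Lemma sin_line_angle_stack (R : realType) m n (a u : 'cV[R]_m)
    (b x : 'cV[R]_n) :
  exists mu, norm2 (u - mu *: a) ^+ 2 + norm2 (x - mu *: b) ^+ 2
    = sin (line_angle (stack a b) (stack u x)) ^+ 2
      * (norm2 u ^+ 2 + norm2 x ^+ 2).
Proof.
have [mu mu_min] := sin_line_angle_eq_dist (stack a b) (stack u x).
have s2 : (Num.sqrt 2 : R)^-1 != 0 by rewrite invr_eq0 gt_eqF// sqrtr_gt0.
(* The factor 1/2 = (1/sqrt 2)^2 coming from stack is restored on both sides. *)
exists mu; apply: (mulfI s2); apply: (mulfI s2).
transitivity (norm2 (stack u x - mu *: stack a b) ^+ 2).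
  rewrite /stack scalerA (mulrC mu) -scalerA -scalerBr.
  rewrite scale_col_mx opp_col_mx add_col_mx !sqr_norm2 dotvZl dotvZr.
  by rewrite dotv_col_mx.
rewrite mu_min exprMn !sqr_norm2 /stack dotvZl dotvZr dotv_col_mx.
by rewrite !(mulrCA _ (sin _ ^+ 2)).
Qed.

(** * GSVD components *)

Lemma mulmx_diag_delta (R : realType) k l (M : 'M[R]_(k, l)) (d : 'rV[R]_l) i :
  M *m diag_mx d *m delta_mx i 0 = d 0 i *: col i M.
Proof.
apply/colP => j; rewrite -colE !mxE (bigD1 i)//= big1 ?addr0.
  by rewrite !mxE eqxx mulr1n mulrC.
by move=> h hi; rewrite !mxE (negbTE hi) mulr0n mulr0.
Qed.

(** All that the bounds and the eigenvector equation use of the GSVD.  The last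
    equation compares two multiples of a column of the inverse transpose of X;
    writing it without quotients avoids naming that column. *)
Lemma gsvd_component_props (R : realType) m p n (A : 'M[R]_(m, n))
    (B : 'M[R]_(p, n)) alpha beta u v x :
  gsvd_component A B alpha beta u v x ->
  [/\ 0 < beta, norm2 u = 1, norm2 v = 1, A *m x = alpha *: u
    & B *m x = beta *: v /\ beta *: (A^T *m u) = alpha *: (B^T *m v)].
Proof.
case=> [al [be [U [V [X [[-> -> agt0 bgt0 _ Xu UU VV]]]]]]].
case=> [i [-> -> -> -> ->]].
have norm_col k (W : 'M[R]_(k, n)) : W^T *m W = 1%:M -> norm2 (col i W) = 1.
  move=> WW; rewrite /norm2 dotvE tr_col -row_mul colE mulmxA WW.
  by rewrite mul1mx !mxE !eqxx sqrtr1.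
have apply_X k (W : 'M[R]_(k, n)) d :
    W *m diag_mx d *m invmx X *m col i X = d 0 i *: col i W.
  by rewrite colE mulmxA mulmxKV// mulmx_diag_delta.
have apply_tr k (W : 'M[R]_(k, n)) d : W^T *m W = 1%:M ->
    (W *m diag_mx d *m invmx X)^T *m col i W
    = d 0 i *: ((invmx X)^T *m delta_mx i 0).
  move=> WW; rewrite !trmx_mul tr_diag_mx colE -!mulmxA (mulmxA W^T) WW mul1mx.
  rewrite scalemxAr; congr (_ *m _).
  by rewrite -[diag_mx d]mul1mx mulmx_diag_delta col1.
split; rewrite ?norm_col ?apply_X//.
by rewrite !apply_tr// !scalerA mulrC.
Qed.

Theorem theorem3p2 (R : realType) (m p n : nat)
    (A : 'M[R]_(m, n)) (B : 'M[R]_(p, n))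
    (le_n_m : (n <= m)%N) (le_n_p : (n <= p)%N)
    (rankA : \rank A = n) (rankB : \rank B = n)
    (alpha beta : R) (u : 'cV[R]_m) (v : 'cV[R]_p) (x : 'cV[R]_n)
    (comp : gsvd_component A B alpha beta u v x) :
  let sigma := alpha / beta in
  let xb := beta^-1 *: x in
  let y := stack u xb in
  [/\ norm2 xb >= 1 / opnorm2 B,
      pencil_eigenvector (hatA A) (hatB m B) sigma y
    & forall (uh : 'cV[R]_m) (xh : 'cV[R]_n),
        norm2 uh = 1 -> xh != 0 ->
        let yh := stack uh xh in
        let vh := (norm2 (B *m xh))^-1 *: (B *m xh) in
        [/\ sin (line_angle xh x)
              <= Num.sqrt (1 + 1 / norm2 xb ^+ 2) * sin (line_angle yh y),
            sin (line_angle uh u)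
              <= Num.sqrt (1 + norm2 xb ^+ 2) * sin (line_angle yh y)
          & sin (line_angle vh v)
              <= opnorm2 B * Num.sqrt (1 + norm2 xb ^+ 2)
                 * sin (line_angle yh y)]].
Proof.
move=> sigma xb y.
have [bgt0 nu nv Ax [Bx Atu]] := gsvd_component_props comp.
have b0 : beta != 0 by rewrite gt_eqF.
have Bxb : B *m xb = v by rewrite -scalemxAr Bx scalerA mulVf// scale1r.
have Axb : A *m xb = sigma *: u.
  by rewrite -scalemxAr Ax scalerA mulrC.
have one_le : 1 <= opnorm2 B * norm2 xb by rewrite -nv -Bxb norm2_mulmx_le.
have B_ge0 := opnorm2_ge0 B.
have xb_gt0 : 0 < norm2 xb.
  rewrite lt_neqAle norm2_ge0 andbT eq_sym; apply: contraTneq one_le => ->.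
  by rewrite mulr0 ler10.
have B_gt0 : 0 < opnorm2 B.
  rewrite lt_neqAle B_ge0 andbT eq_sym; apply: contraTneq one_le => ->.
  by rewrite mul0r ler10.
have s2 : (Num.sqrt 2 : R)^-1 != 0 by rewrite invr_eq0 gt_eqF// sqrtr_gt0.
split.
- by rewrite ler_pdivrMr// mulrC.
- split.
    rewrite scaler_eq0 negb_or s2 /=; apply/eqP => ux0.
    have /eqP : norm2 u = 0.
      apply/eqP; rewrite norm2_eq0 -(col_mxKu u xb) ux0.
      by apply/eqP/colP => i; rewrite !mxE.
    by rewrite nu oner_eq0.
  rewrite /y /stack -!scalemxAr scalerA mulrC -scalerA; congr (_ *: _).
  rewrite /hatA /hatB !mul_block_col !mul0mx mul1mx !addr0 !add0r Axb.
  rewrite -mulmxA Bxb scale_col_mx; congr col_mx.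
  by rewrite /sigma mulrC -scalerA -Atu scalerA mulVf// scale1r.
move=> uh xh nuh xh0 yh vh.
have [mu] := sin_line_angle_stack uh u xh xb.
rewrite nu expr1n -/y -/yh; set s := sin (line_angle yh y) => split_dist.
have s_ge0 : 0 <= s by exact: sin_line_angle_ge0.
have dist_le (t : R) : 0 <= t -> t ^+ 2 <= s ^+ 2 * (1 + norm2 xb ^+ 2) ->
    t <= Num.sqrt (1 + norm2 xb ^+ 2) * s.
  move=> t0; rewrite -(@ler_pXn2r _ 2 _ t)// ?nnegrE ?mulr_ge0 ?sqrtr_ge0//.
  rewrite exprMn (@sqr_sqrtr _ (1 + _)) ?addr_ge0 ?sqr_ge0//.
  by rewrite [leRHS]mulrC.
have distu : norm2 (u - mu *: uh) <= Num.sqrt (1 + norm2 xb ^+ 2) * s.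
  by apply: dist_le; rewrite ?norm2_ge0// -split_dist lerDl sqr_ge0.
have distx : norm2 (xb - mu *: xh) <= Num.sqrt (1 + norm2 xb ^+ 2) * s.
  by apply: dist_le; rewrite ?norm2_ge0// -split_dist lerDr sqr_ge0.
split.
- have sx : sin (line_angle xh x) * norm2 xb <= norm2 (xb - mu *: xh).
    (* x = beta *: xb, so beta * mu is the coefficient adapted to x. *)
    rewrite norm2Z mulrCA.
    have -> : xb - mu *: xh = beta^-1 *: (x - (beta * mu) *: xh).
      by rewrite scalerBr scalerA mulKf.
    by rewrite norm2Z ler_wpM2l// sin_line_angle_le_dist.
  rewrite -(ler_pM2r xb_gt0); apply: (le_trans sx); apply: (le_trans distx).
  (* The factor |xb| is absorbed into the square root. *)
  have sqrt_scale (t : R) : 0 < t ->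
      Num.sqrt (1 + t ^+ 2) = Num.sqrt (1 + 1 / t ^+ 2) * t.
    move=> t0; rewrite -[X in _ = _ * X]ger0_norm ?ltW// -sqrtr_sqr -sqrtrM.
      by congr Num.sqrt; field; rewrite gt_eqF.
    by rewrite addr_ge0 ?divr_ge0 ?sqr_ge0.
  by rewrite sqrt_scale// mulrAC.
- by apply: le_trans distu; rewrite -[sin _]mulr1 -nu sin_line_angle_le_dist.
have sv : sin (line_angle vh v) <= norm2 (v - mu *: (B *m xh)).
  (* mu *: (B *m xh) has to be rewritten as a multiple of the unit vector vh. *)
  have [Bxh0|Bxh0] := eqVneq (norm2 (B *m xh)) 0.
    have -> : mu *: (B *m xh) = 0 *: vh.
      by move/eqP: Bxh0; rewrite norm2_eq0 => /eqP ->; rewrite scaler0 scale0r.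
    by rewrite -[sin _]mulr1 -nv sin_line_angle_le_dist.
  have -> : mu *: (B *m xh) = (mu * norm2 (B *m xh)) *: vh.
    by rewrite scalerA mulfK.
  by rewrite -[sin _]mulr1 -nv sin_line_angle_le_dist.
apply: (le_trans sv).
rewrite -Bxb scalemxAr -mulmxBr; apply: (le_trans (norm2_mulmx_le _ _)).
by rewrite -mulrA ler_wpM2l.
Qed.
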